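(* Let $G=(V=[n],E)$ be a graph with positive node weights $w\in\mathbb{R}^V$, and let $B\in\mathcal{M}(G,w)$. Consider the problem $$\min\{p_B(x)=x^TBx:x\in\Delta_n\},\qquad(\ast)$$ whose optimal value is $1/\alpha(G,w)$. The following assertions are equivalent. (i) Problem $(\ast)$ has finitely many global minimizers. (ii) $B_{ij}>\frac12\big(\frac1{w_i}+\frac1{w_j}\big)$ for all edges $\{i,j\}\in E$ that are $w$-critical. (iii) The optimality conditions (FOOC), (SCC) and (SOSC) hold at all the global minimizers of $(\ast)$. In that case the global minimizers are the vectors $x\in\Delta_n$ with entries $x_i=w_i/\alpha(G,w)$ for $i\in S$ and $x_i=0$ for $i\in V\setminus S$, where $S$ is a $w$-maximum stable set of $G$.
   Context: Graphs are finite and simple. $\Delta_n=\{x\in\mathbb{R}^n:x\ge0,\sum_{i=1}^nx_i=1\}$. For $S\subseteq V$, $w(S)=\sum_{i\in S}w_i$. $\alpha(G,w)$ is the maximum of $w(S)$ over stable sets $S$ of $G$; a stable set attaining it is called $w$-maximum. An edge $\{i,j\}\in E$ is $w$-critical if there exists $R\subseteq V$ such that both $R\cup\{i\}$ and $R\cup\{j\}$ are $w$-maximum stable sets. $\mathcal{M}(G,w)$ is the set of real symmetric $n\times n$ matrices $B$ with $B_{ii}=1/w_i$ for $i\in V$, $B_{ij}\ge\frac12(B_{ii}+B_{jj})$ for $\{i,j\}\in E$, and $B_{ij}=0$ for $i\ne j$, $\{i,j\}\notin E$. It is known that for every $B\in\mathcal{M}(G,w)$ the minimum of $x^TBx$ over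 $\Delta_n$ is $1/\alpha(G,w)$. Optimality conditions, for problem $(\ast)$ written with inequality constraints $g_i(x)=x_i\ge0$ ($i\in[n]$) and equality constraint $h(x)=\sum_{i=1}^nx_i-1=0$: for a feasible $u$ let $J(u)=\{i\in[n]:u_i=0\}$. The conditions hold at $u$ if there are multipliers $\lambda\in\mathbb{R}$ and $\mu\in\mathbb{R}^n$ such that: (FOOC) $\nabla p_B(u)=\lambda e+\sum_{i=1}^n\mu_ie_i$, where $e$ is the all-ones vector and $e_i$ the standard unit vectors (together with $\mu_i\ge0$ and $\mu_iu_i=0$ for all $i$); (SCC) $\mu_i>0$ for every $i\in J(u)$ and $\mu_i=0$ for $i\in[n]\setminus J(u)$; (SOSC) with $L(x)=p_B(x)-\lambda(\sum_ix_i-1)-\sum_{i\in J(u)}\mu_ix_i$, one has $v^T\nabla^2L(u)v>0$ for all $0\ne v\in\mathbb{R}^n$ such that $\sum_iv_i=0$ and $v_i=0$ for all $i\in J(u)$. *)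

(* Defs.v *)
From HB Require Import structures.
From mathcomp Require Import all_boot all_order all_algebra.
From mathcomp Require Import all_classical all_reals all_analysis.

Set Implicit Arguments.
Unset Strict Implicit.
Unset Printing Implicit Defensive.

Import Order.TTheory GRing.Theory Num.Theory.
Import numFieldNormedType.Exports.

Local Open Scope ring_scope.

Definition simple_graph (V : finType) (e : rel V) : Prop :=
  symmetric e /\ irreflexive e.

Definition stable (V : finType) (e : rel V) (S : {set V}) : bool :=
  [forall i in S, forall j in S, ~~ e i j].

Section Weights.
Variables (R : realType) (V : finType) (e : rel V) (w : V -> R).

Definition weight (S : {set V}) : R := \sum_(i in S) w i.

(* The default value 0 of the maximum is the weight of the stable set set0. *)
Definition alpha : R := \big[Num.max/0]_(S : {set V} | stable e S) weight S.

Definition max_stable (S : {set V}) : Prop := stable e S /\ weight S = alpha.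

Definition critical_edge (i j : V) : Prop :=
  e i j /\ exists Q : {set V}, max_stable (i |: Q) /\ max_stable (j |: Q).

End Weights.

Section StandardQuadraticProgram.
Variables (R : realType) (n : nat).
Implicit Types (B : 'M[R]_n) (x u v : 'cV[R]_n) (f : 'cV[R]_n -> R).

Definition Mclass (e : rel 'I_n) (w : 'I_n -> R) B : Prop :=
  [/\ B^T = B,
      forall i, B i i = (w i)^-1,
      forall i j, e i j -> 2^-1 * (B i i + B j j) <= B i j
    & forall i j, i != j -> ~~ e i j -> B i j = 0].

Definition simplex x : Prop :=
  (forall i, 0 <= x i ord0) /\ \sum_i x i ord0 = 1.

Definition qform B x : R := (x^T *m B *m x) ord0 ord0.

Definition global_minimizer B x : Prop :=
  simplex x /\ forall y, simplex y -> qform B x <= qform B y.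

Definition optimal_value B (c : R) : Prop :=
  (exists2 x, simplex x & qform B x = c) /\
  (forall y, simplex y -> c <= qform B y).

Definition unit_vec (i : 'I_n) : 'cV[R]_n := delta_mx i ord0.

Definition grad f u : 'cV[R]_n := \col_i 'D_(unit_vec i) f u.

Definition hess f u : 'M[R]_n :=
  \matrix_(i, j) 'D_(unit_vec i) (fun x => 'D_(unit_vec j) f x) u.

Definition active u : {set 'I_n} := finset (fun i => u i ord0 == 0).

Definition FOOC B u (lambda : R) (mu : 'I_n -> R) : Prop :=
  grad (qform B) u = lambda *: const_mx 1 + \sum_i mu i *: unit_vec i /\
  forall i, 0 <= mu i /\ mu i * u i ord0 = 0.

Definition SCC u (mu : 'I_n -> R) : Prop :=
  (forall i, i \in active u -> 0 < mu i) /\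
  (forall i, i \notin active u -> mu i = 0).

Definition lagrangian B u (lambda : R) (mu : 'I_n -> R) x : R :=
  qform B x - lambda * (\sum_i x i ord0 - 1)
  - \sum_(i in active u) mu i * x i ord0.

Definition SOSC B u (lambda : R) (mu : 'I_n -> R) : Prop :=
  forall v, v != 0 -> \sum_i v i ord0 = 0 ->
    (forall i, i \in active u -> v i ord0 = 0) ->
    0 < (v^T *m hess (lagrangian B u lambda mu) u *m v) ord0 ord0.

Definition optimality_conditions B u : Prop :=
  exists (lambda : R) (mu : 'I_n -> R),
    [/\ FOOC B u lambda mu, SCC u mu & SOSC B u lambda mu].

End StandardQuadraticProgram.

(* Main.v *)
(* Along the direction e_j - e_i of an edge ij the form is concave, its second
   difference being B_ii + B_jj - 2 B_ij <= 0.  Hence, if the support of a point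
   contains an edge, moving all the mass of one endpoint to the other, in one of
   the two ways, does not increase the form; iterating, one reaches a stable
   support S, on which the form is the sum of the x_i^2 / w_i, at least 1/w(S).
   At a minimizer both moves preserve the value and the edge satisfies
   2 B_ij = B_ii + B_jj, so strictness on critical edges forces stable supports.
   Conversely, a tight critical edge yields a segment of minimizers, and strict
   complementarity fails at its ends. *)

Require Import Defs.
From HB Require Import structures.
From mathcomp Require Import all_boot all_order all_algebra.
From mathcomp Require Import all_classical all_reals all_analysis.
From mathcomp Require Import ring lra.

Set Implicit Arguments.
Unset Strict Implicit.
Unset Printing Implicit Defensive.

Import Order.TTheory GRing.Theory Num.Theory.
Import numFieldNormedType.Exports.

Local Open Scope ring_scope.

(** * Directional derivatives of quadratic forms *)

Section QuadraticForms.
Variables (R : realType) (n : nat).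
Implicit Types (B : 'M[R]_n) (u v x y : 'cV[R]_n) (a c d : R).

(** Along a line, the functions to be differentiated are polynomials of degree at most 2, so the
    difference quotient is [c + h * d], with limit [c] at 0. Gradient and Hessian thus reduce to
    algebra. *)
Lemma derive_affine_quadratic (f : 'cV[R]_n -> R) u v c d :
  (forall h : R, f (h *: v + u) - f u = h * (c + h * d)) -> 'D_v f u = c.
Proof.
move=> fE; rewrite /derive; apply: cvg_lim => //.
have cvgc : ((c + h * d) @[h --> (0 : R)^'] --> c)%classic.
  have {2}-> : c = c + 0 * d by rewrite mul0r addr0.
  apply: (@cvg_within_filter _ _ (fun h : R => c + h * d)).
  by apply: cvgD; [exact: cvg_cst|apply: cvgMl; exact: cvg_id].
apply: cvg_trans cvgc; apply: near_eq_cvg.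
near=> h; rewrite /= fE /GRing.scale/= mulKf //.
by near: h; exact: nbhs_dnbhs_neq.
Unshelve. all: by end_near. Qed.

Definition bform B x y : R := (x^T *m B *m y) ord0 ord0.

Lemma qformE B x : qform B x = bform B x x. Proof. by []. Qed.

Lemma bformDl B x y z : bform B (x + y) z = bform B x z + bform B y z.
Proof. by rewrite /bform linearD/= !mulmxDl mxE. Qed.

Lemma bformDr B x y z : bform B x (y + z) = bform B x y + bform B x z.
Proof. by rewrite /bform mulmxDr mxE. Qed.

Lemma bformZl B a x y : bform B (a *: x) y = a * bform B x y.
Proof. by rewrite /bform linearZ/= -!scalemxAl mxE. Qed.

Lemma bformZr B a x y : bform B x (a *: y) = a * bform B x y.
Proof. by rewrite /bform -scalemxAr mxE. Qed.

Lemma bformC B x y : B^T = B -> bform B x y = bform B y x.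
Proof.
move=> sB; have -> : bform B x y = (x^T *m B *m y)^T ord0 ord0 by rewrite mxE.
by rewrite !trmx_mul sB trmxK mulmxA.
Qed.

Lemma bform_unit_vec B i x : bform B (unit_vec R i) x = (B *m x) i ord0.
Proof. by rewrite /bform /unit_vec trmx_delta -mulmxA -rowE mxE. Qed.

Lemma bform_unit_vec2 B i j : bform B (unit_vec R i) (unit_vec R j) = B i j.
Proof. by rewrite bform_unit_vec /unit_vec -colE mxE. Qed.

Lemma qformD B x y : B^T = B ->
  qform B (x + y) = qform B x + bform B x y *+ 2 + qform B y.
Proof.
by move=> sB; rewrite !qformE bformDl !bformDr (bformC y x sB); ring.
Qed.

Lemma qformZ B a x : qform B (a *: x) = a ^+ 2 * qform B x.
Proof. by rewrite !qformE bformZl bformZr mulrA expr2. Qed.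

Lemma sum_unit_vecE (mu : 'I_n -> R) i :
  (\sum_k mu k *: unit_vec R k) i ord0 = mu i.
Proof.
rewrite summxE (bigD1 i)//= !mxE !eqxx mulr1 big1 ?addr0// => k ki.
by rewrite !mxE eq_sym (negPf ki) mulr0.
Qed.

Lemma grad_qform B u : B^T = B -> grad (qform B) u = 2 *: (B *m u).
Proof.
move=> sB; apply/colP => i; rewrite !mxE.
apply: (derive_affine_quadratic (d := qform B (unit_vec R i))) => h.
rewrite qformD// qformZ bformZl bform_unit_vec mxE; ring.
Qed.

Lemma hess_lagrangian B u (lambda : R) (mu : 'I_n -> R) : B^T = B ->
  hess (lagrangian B u lambda mu) u = 2 *: B.
Proof.
move=> sB; apply/matrixP => i j; rewrite !mxE.
(* This derivative is needed at every [x], as it is differentiated again. The linear terms of the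
   Lagrangian contribute constants to it, so it is affine in [x], whence [d := 0] below. *)
have DL x : 'D_(unit_vec R j) (lagrangian B u lambda mu) x =
    2 * bform B (unit_vec R j) x - lambda * \sum_k unit_vec R j k ord0
    - \sum_(k in active u) mu k * unit_vec R j k ord0.
  apply: (derive_affine_quadratic (d := qform B (unit_vec R j))) => h.
  rewrite /lagrangian qformD// qformZ bformZl.
  have -> : \sum_k (h *: unit_vec R j + x) k ord0 =
      h * (\sum_k unit_vec R j k ord0) + \sum_k x k ord0.
    by rewrite mulr_sumr -big_split; apply: eq_bigr => k _; rewrite !mxE.
  have -> : \sum_(k in active u) mu k * (h *: unit_vec R j + x) k ord0 =
      h * (\sum_(k in active u) mu k * unit_vec R j k ord0) +
      \sum_(k in active u) mu k * x k ord0.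
    by rewrite mulr_sumr -big_split /=; apply: eq_bigr => k _; rewrite !mxE; ring.
  ring.
apply: (derive_affine_quadratic (d := 0)) => h; rewrite !DL.
rewrite bformDr bformZr bform_unit_vec2 -{1}sB mxE; ring.
Qed.

End QuadraticForms.

(** * Weighted stable sets *)

Section WeightedGraph.
Variables (R : realType) (n : nat) (e : rel 'I_n) (w : 'I_n -> R) (B : 'M[R]_n).
Hypotheses (he : simple_graph e) (hw : forall i, 0 < w i) (hB : Mclass e w B).
Implicit Types (x y : 'cV[R]_n) (S Q : {set 'I_n}) (i j : 'I_n).

Let symB : B^T = B. Proof. by case: hB. Qed.
Let diagB i : B i i = (w i)^-1. Proof. by case: hB => _ + _ _; exact. Qed.
Let edge_sym : symmetric e. Proof. by case: he. Qed.
Let edge_irr : irreflexive e. Proof. by case: he. Qed.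
Let BC i j : B i j = B j i. Proof. by rewrite -{1}symB mxE. Qed.

Local Notation alpha := (alpha e w).

Definition support x : {set 'I_n} := ~: active x.

(** The division is by [alpha], not by [weight w S]: the entries sum to 1 only if [S] has weight
    [alpha]. *)
Definition char_vec S : 'cV[R]_n := \col_i (if i \in S then w i / alpha else 0).

Lemma in_support x i : (i \in support x) = (x i ord0 != 0).
Proof. by rewrite !inE. Qed.

Lemma stableP S :
  reflect (forall i j, i \in S -> j \in S -> ~~ e i j) (stable e S).
Proof.
apply: (iffP forall_inP) => [H i j iS jS|H i iS].
  by have /forall_inP := H i iS; exact.
by apply/forall_inP => j; exact: H.
Qed.

Lemma weight_le_alpha S : stable e S -> weight w S <= alpha.
Proof. exact: le_bigmax_cond. Qed.

Lemma max_stable_exists : exists S, max_stable e w S.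
Proof.
have st0 : stable e finset.set0 by apply/stableP => i j; rewrite inE.
(* Weights are nonnegative, so the default value 0 does not exceed any of them and the maximum is
   attained. *)
have [|S stS aE] := @eq_bigmax _ _ _ 0 _ (stable e) (weight w) st0.
  by move=> S _; apply: sumr_ge0 => i _; exact: ltW.
by exists S.
Qed.

Lemma alpha_gt0 : (0 < n)%N -> 0 < alpha.
Proof.
move=> n0; apply: (lt_le_trans (hw (Ordinal n0))).
apply: (le_trans _ (@weight_le_alpha [set Ordinal n0]%SET _)).
  by rewrite /weight big_set1.
by apply/stableP => i j; rewrite !inE => /eqP-> /eqP->; rewrite edge_irr.
Qed.

(** * The form on vectors with stable support *)

Lemma qform_sum x : qform B x = \sum_i x i ord0 * (B *m x) i ord0.
Proof.
by rewrite /qform -mulmxA mxE; apply: eq_bigr => i _; rewrite [X in X * _]mxE.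
Qed.

Lemma mulmx_stable S x i : stable e S -> (forall j, j \notin S -> x j ord0 = 0) ->
  i \in S -> (B *m x) i ord0 = x i ord0 / w i.
Proof.
move=> /stableP stS x0 iS; rewrite mxE (bigD1 i)//= diagB mulrC big1 ?addr0//.
move=> j ji; have [jS|/x0->] := boolP (j \in S); last by rewrite mulr0.
by case: hB => _ _ _ ->; rewrite ?mul0r 1?eq_sym ?stS.
Qed.

Lemma qform_stable S x : stable e S -> (forall j, j \notin S -> x j ord0 = 0) ->
  qform B x = \sum_(i in S) x i ord0 ^+ 2 / w i.
Proof.
move=> stS x0; rewrite qform_sum (bigID (mem S))/= [X in _ + X]big1 ?addr0.
  by apply: eq_bigr => i iS; rewrite (mulmx_stable stS)// mulrA.
by move=> i iS; rewrite x0// mul0r.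
Qed.

(** Completing the square at [x i = w i / alpha] writes the excess over [alpha^-1] as two
    nonnegative terms: the missing weight of [S] and a distance from [char_vec S]. The lower bound
    and its equality case both follow. *)
Lemma qform_stable_gap S x : 0 < alpha ->
    stable e S -> (forall j, j \notin S -> x j ord0 = 0) ->
    \sum_i x i ord0 = 1 ->
  qform B x = alpha^-1 + ((alpha - weight w S) / alpha ^+ 2
    + \sum_(i in S) w i * (x i ord0 / w i - alpha^-1) ^+ 2).
Proof.
move=> a0 stS x0 x1; rewrite (qform_stable stS)//.
have x1S : \sum_(i in S) x i ord0 = 1.
  by rewrite -x1 [RHS](bigID (mem S))/= [X in _ + X]big1 ?addr0.
have -> : \sum_(i in S) w i * (x i ord0 / w i - alpha^-1) ^+ 2 =
   \sum_(i in S) x i ord0 ^+ 2 / w i - 2 / alpha * (\sum_(i in S) x i ord0)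
   + (weight w S) / alpha ^+ 2.
  rewrite mulr_sumr /weight mulr_suml -sumrB -big_split/=.
  apply: eq_bigr => i _; have := hw i => wi; field.
  by rewrite !gt_eqF.
by rewrite x1S; field; rewrite gt_eqF.
Qed.

Lemma qform_stable_ge S x : 0 < alpha ->
    stable e S -> (forall j, j \notin S -> x j ord0 = 0) ->
    \sum_i x i ord0 = 1 ->
  alpha^-1 <= qform B x.
Proof.
move=> a0 stS x0 x1; rewrite (qform_stable_gap a0 stS)// lerDl addr_ge0//.
  by rewrite divr_ge0 ?sqr_ge0// subr_ge0 weight_le_alpha.
by apply: sumr_ge0 => i _; rewrite mulr_ge0 ?sqr_ge0 ?ltW.
Qed.

Lemma qform_stable_eq S x : 0 < alpha ->
    stable e S -> (forall j, j \notin S -> x j ord0 = 0) ->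
    \sum_i x i ord0 = 1 -> qform B x = alpha^-1 ->
  max_stable e w S /\ x = char_vec S.
Proof.
move=> a0 stS x0 x1; rewrite (qform_stable_gap a0 stS)//.
move/eqP; rewrite -subr_eq0 addrC addKr paddr_eq0; last 2 first.
- by rewrite divr_ge0 ?sqr_ge0// subr_ge0 weight_le_alpha.
- by apply: sumr_ge0 => i _; rewrite mulr_ge0 ?sqr_ge0 ?ltW.
rewrite mulf_eq0 invr_eq0 expf_eq0/= (gt_eqF a0) orbF subr_eq0.
move=> /andP[/eqP aE /eqP /psumr_eq0P s0]; split; first by split.
apply/colP => i; rewrite mxE; case: ifPn => [iS|/x0//].
have /eqP := s0 (fun i _ => mulr_ge0 (ltW (hw i)) (sqr_ge0 _)) i iS.
rewrite mulf_eq0 expf_eq0/= (gt_eqF (hw i))/= subr_eq0 => /eqP <-.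
by rewrite mulrC divfK// gt_eqF.
Qed.

Lemma char_vecE S i :
  char_vec S i ord0 = if i \in S then w i / alpha else 0.
Proof. by rewrite mxE. Qed.

Lemma char_vec_notin S i : i \notin S -> char_vec S i ord0 = 0.
Proof. by rewrite char_vecE => /negPf->. Qed.

Lemma char_vec_simplex S : 0 < alpha -> max_stable e w S -> simplex (char_vec S).
Proof.
move=> a0 [_ wS]; split=> [i|].
  by rewrite char_vecE; case: ifP => // _; rewrite divr_ge0 ?ltW.
under eq_bigr do rewrite char_vecE.
by rewrite -big_mkcond -mulr_suml -/(weight w S) wS divff// gt_eqF.
Qed.

Lemma qform_char_vec S : 0 < alpha -> max_stable e w S ->
  qform B (char_vec S) = alpha^-1.
Proof.
move=> a0 mS; have [_ c1] := char_vec_simplex a0 mS; case: mS => stS wS.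
rewrite (qform_stable_gap a0 stS (@char_vec_notin S) c1) wS subrr mul0r add0r.
rewrite big1 ?addr0// => i iS; rewrite char_vecE iS.
by rewrite mulrAC divff ?gt_eqF// mul1r subrr expr0n mulr0.
Qed.

(** * Moving mass along an edge *)

Definition transfer x i j : 'cV[R]_n :=
  x + x i ord0 *: (unit_vec R j - unit_vec R i).

Lemma transferE x i j k : transfer x i j k ord0 =
  x k ord0 + x i ord0 * ((k == j)%:R - (k == i)%:R).
Proof. by rewrite !mxE !eqxx !andbT. Qed.

Lemma simplex_transfer x i j : simplex x -> i != j -> simplex (transfer x i j).
Proof.
move=> [x0 x1] ij; split=> [k|].
  rewrite transferE; have [->|kj] := eqVneq k j.
    by rewrite eq_sym (negPf ij) subr0 mulr1 addr_ge0.
  have [->|ki] := eqVneq k i; first by rewrite sub0r mulrN1 subrr.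
  by rewrite subrr mulr0 addr0.
under eq_bigr do rewrite transferE.
have delta1 l : \sum_k (k == l)%:R = 1 :> R.
  by rewrite (bigD1 l)//= eqxx big1 ?addr0// => k /negPf->.
by rewrite big_split -mulr_sumr sumrB/= x1 !delta1 subrr mulr0 addr0.
Qed.

(** The entry at [j] is positive and cannot decrease, so only [i] can leave the support. This
    decrease drives the inductions on the size of the support. *)
Lemma support_transfer x i j : simplex x -> i != j ->
  j \in support x -> support (transfer x i j) = support x :\ i.
Proof.
move=> [x0 _] ij; rewrite in_support => xj; apply/setP => k.
rewrite !inE -!in_support !in_support transferE.
have [->|ki] := eqVneq k i.
  by rewrite (negPf ij) sub0r mulrN1 subrr eqxx.
have [->|kj] := eqVneq k j; last by rewrite subrr mulr0 addr0.
by rewrite xj subr0 mulr1 gt_eqF// ltr_wpDr// lt_def xj x0.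
Qed.

(** With [d = unit_vec R j - unit_vec R i], the two transfers are [x + x_i d] and [x - x_j d]. The
    weights [x_j] and [x_i] cancel the first-order terms, and what remains is
    [qform B d = B i i + B j j - 2 * B i j]. *)
Lemma qform_transfer x i j :
  x j ord0 * qform B (transfer x i j) + x i ord0 * qform B (transfer x j i) =
  (x i ord0 + x j ord0) *
    (qform B x - x i ord0 * x j ord0 * (B i j *+ 2 - (B i i + B j j))).
Proof.
rewrite /transfer -(opprB (unit_vec R j)) scalerN -scaleNr.
set d := unit_vec R j - unit_vec R i.
have qd : qform B d = (B i i + B j j) - B i j *+ 2.
  rewrite /d qformD// -scaleN1r qformZ bformZr !qformE !bform_unit_vec2 (BC j i).
  ring.
rewrite !(qformD _ _ symB) !bformZr !qformZ qd; ring.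
Qed.

Lemma edge_excess_ge0 i j : e i j -> 0 <= B i j *+ 2 - (B i i + B j j).
Proof. by case: hB => _ _ + _ => /[apply]; lra. Qed.

Lemma unstable_support x : ~~ stable e (support x) ->
  exists i j, [/\ i \in support x, j \in support x, e i j & i != j].
Proof.
move=> nst; have : ~ (forall i j, i \in support x -> j \in support x -> ~~ e i j).
  by move/stableP; exact/negP.
move/existsNP => [i /existsNP[j /not_implyP[ix /not_implyP[jx /negP]]]].
rewrite negbK => eij; exists i, j; split => //.
by apply: contraTneq eij => ->; rewrite edge_irr.
Qed.

Lemma notin_support x i : i \notin support x -> x i ord0 = 0.
Proof. by rewrite in_support negbK => /eqP. Qed.

(** * The optimal value and the points attaining it *)

(** Induction on the size of the support. For an edge inside it, both transfers satisfy the bound,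
    and by [qform_transfer] their weighted mean is at most the form at [x]; no choice of the better
    transfer is made. *)
Lemma simplex_qform_ge x : 0 < alpha -> simplex x -> alpha^-1 <= qform B x.
Proof.
move=> a0; have [k] := ubnP #|support x|; elim: k x => // k IH x kx sx.
have [stx|/unstable_support[i [j [ix jx eij ij]]]] := boolP (stable e (support x)).
  by apply: (qform_stable_ge a0 stx (@notin_support x)); case: sx.
have [x0 _] := sx.
have xi0 : 0 < x i ord0 by rewrite lt_def -in_support ix x0.
have xj0 : 0 < x j ord0 by rewrite lt_def -in_support jx x0.
have ji : j != i by rewrite eq_sym.
have pi : alpha^-1 <= qform B (transfer x i j).
  apply: IH (simplex_transfer sx ij); rewrite support_transfer//.
  by rewrite -ltnS; move: kx; rewrite (cardsD1 i) ix.
have pj : alpha^-1 <= qform B (transfer x j i).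
  apply: IH (simplex_transfer sx ji); rewrite support_transfer//.
  by rewrite -ltnS; move: kx; rewrite (cardsD1 j) jx.
rewrite -(ler_pM2l (addr_gt0 xi0 xj0)).
have -> : (x i ord0 + x j ord0) * qform B x =
    x j ord0 * qform B (transfer x i j) + x i ord0 * qform B (transfer x j i) +
    (x i ord0 + x j ord0) *
      (x i ord0 * x j ord0 * (B i j *+ 2 - (B i i + B j j))).
  by rewrite qform_transfer; ring.
apply: ler_wpDr; first by rewrite !mulr_ge0 ?(edge_excess_ge0 eij)// ?addr_ge0 ?ltW.
by rewrite mulrDl addrC lerD// ler_pM2l.
Qed.

Lemma optimal_valueE : 0 < alpha -> optimal_value B alpha^-1.
Proof.
move=> a0; have [S mS] := max_stable_exists; split; last first.
  by move=> y; exact: simplex_qform_ge.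
by exists (char_vec S); [exact: char_vec_simplex|exact: qform_char_vec].
Qed.

Lemma global_minimizerE x : 0 < alpha ->
  global_minimizer B x <-> simplex x /\ qform B x = alpha^-1.
Proof.
move=> a0; have [[y sy yE] ge] := optimal_valueE a0.
split=> [[sx xm]|[sx xE]]; split=> //; last by move=> z /ge; rewrite xE.
by apply/eqP; rewrite eq_le ge// andbT -yE xm.
Qed.

Lemma global_minimizer_char_vec S : 0 < alpha -> max_stable e w S ->
  global_minimizer B (char_vec S).
Proof.
move=> a0 mS; apply/(global_minimizerE _ a0); split.
  exact: char_vec_simplex.
exact: qform_char_vec.
Qed.

Lemma global_minimizer_stable x : 0 < alpha -> global_minimizer B x ->
  stable e (support x) ->
  max_stable e w (support x) /\ x = char_vec (support x).
Proof.
move=> a0 /(global_minimizerE _ a0)[[_ x1] xE] stx.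
exact: (qform_stable_eq a0 stx (@notin_support x)).
Qed.

(** * Finiteness and strictness on critical edges *)

Definition strict_on_critical_edges : Prop := forall i j, critical_edge e w i j ->
  2^-1 * ((w i)^-1 + (w j)^-1) < B i j.

(** At a minimizer, [qform_transfer] says that a positive combination of three nonnegative
    quantities is zero: the excess of each transfer over [alpha^-1] and the slack [c] of the edge.
    Hence all three vanish. *)
Lemma minimizer_transfer x i j : 0 < alpha -> global_minimizer B x ->
  i \in support x -> j \in support x -> e i j -> i != j ->
  [/\ global_minimizer B (transfer x i j), global_minimizer B (transfer x j i)
    & B i j = 2^-1 * ((w i)^-1 + (w j)^-1)].
Proof.
move=> a0 /(global_minimizerE _ a0)[sx xE] ix jx eij ij.
have [x0 _] := sx.
have xi0 : 0 < x i ord0 by rewrite lt_def -in_support ix x0.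
have xj0 : 0 < x j ord0 by rewrite lt_def -in_support jx x0.
have ji : j != i by rewrite eq_sym.
have pi := simplex_qform_ge a0 (simplex_transfer sx ij).
have pj := simplex_qform_ge a0 (simplex_transfer sx ji).
have := edge_excess_ge0 eij; rewrite !diagB.
have := qform_transfer x i j; rewrite xE !diagB.
set p := qform B (transfer x i j) in pi *.
set q := qform B (transfer x j i) in pj *.
set c := B i j *+ 2 - _ => E c0.
have h1 : 0 <= x j ord0 * (p - alpha^-1) by rewrite mulr_ge0 ?subr_ge0// ltW.
have h2 : 0 <= x i ord0 * (q - alpha^-1) by rewrite mulr_ge0 ?subr_ge0// ltW.
have h3 : 0 <= (x i ord0 + x j ord0) * (x i ord0 * x j ord0 * c).
  by rewrite !mulr_ge0// ?addr_ge0 ?ltW.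
have h : x j ord0 * (p - alpha^-1) + x i ord0 * (q - alpha^-1) +
  (x i ord0 + x j ord0) * (x i ord0 * x j ord0 * c) = 0.
  rewrite -[RHS](subrr ((x i ord0 + x j ord0) *
    (alpha^-1 - x i ord0 * x j ord0 * c))) -{1}E; ring.
move/eqP: h; rewrite !paddr_eq0 ?addr_ge0//.
rewrite !mulf_eq0 (gt_eqF xi0) (gt_eqF xj0) (gt_eqF (addr_gt0 xi0 xj0))/=.
rewrite !subr_eq0 => /andP[/andP[/eqP pE /eqP qE] /eqP c0E].
split; [| |lra]; apply/(global_minimizerE _ a0); split => //;
  exact: simplex_transfer.
Qed.

(* In a minimizer with unstable support of least size, emptying either endpoint
   of an edge of the support leaves a stable support, so that edge is critical. *)
Lemma minimizer_support_stable x : 0 < alpha -> strict_on_critical_edges ->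
  global_minimizer B x -> stable e (support x).
Proof.
move=> a0 strict; have [k] := ubnP #|support x|.
elim: k x => // k IH x kx mx; apply/negPn/negP.
move=> /unstable_support[i [j [ix jx eij ij]]].
have [mi mj Bij] := minimizer_transfer a0 mx ix jx eij ij.
have ji : j != i by rewrite eq_sym.
have [sx _] := mx.
have si := support_transfer sx ij jx.
have sj := support_transfer sx ji ix.
have [|Mi _] := global_minimizer_stable a0 mi (IH _ _ mi).
  by rewrite si -ltnS; move: kx; rewrite (cardsD1 i) ix.
have [|Mj _] := global_minimizer_stable a0 mj (IH _ _ mj).
  by rewrite sj -ltnS; move: kx; rewrite (cardsD1 j) jx.
suff /strict : critical_edge e w i j by rewrite Bij ltxx.
(* The witness is the intersection of the two maximum stable supports; adding [i] gives the one
   where [j] was emptied, and vice versa. *)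
split=> //; exists (support x :\ i :\ j); split.
  suff -> : i |: (support x :\ i :\ j) = support (transfer x j i) by [].
  rewrite sj; apply/setP => k'; rewrite !inE.
  by have [->|] := eqVneq k' i => //=; rewrite ij; move: ix; rewrite !inE => ->.
suff -> : j |: (support x :\ i :\ j) = support (transfer x i j) by [].
rewrite si; apply/setP => k'; rewrite !inE.
by have [->|] := eqVneq k' j => //=; rewrite ji; move: jx; rewrite !inE => ->.
Qed.

(** Each minimizer is the characteristic vector of its support, and there are finitely many subsets
    of vertices. *)
Lemma strict_finite : 0 < alpha -> strict_on_critical_edges ->
  finite_set [set x | global_minimizer B x]%classic.
Proof.
move=> a0 strict; apply: (sub_finite_set (B := range char_vec)%classic).
  move=> x /= mx; have stx := minimizer_support_stable a0 strict mx.
  by have [_ xE] := global_minimizer_stable a0 mx stx; exists (support x).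
exact/finite_image/finite_finset.
Qed.

(** If [i] were in [Q], the stable set [j |: Q] would contain the edge; likewise for [j]. The weight
    of [Q] then cancels. Equal weights make the two characteristic vectors differ by a multiple of
    [unit_vec R i - unit_vec R j]. *)
Lemma max_stable_swap_weight i j Q : e i j ->
  max_stable e w (i |: Q) -> max_stable e w (j |: Q) ->
  [/\ i \notin Q, j \notin Q & w i = w j].
Proof.
move=> eij [/stableP sti wi] [/stableP stj wj].
have iQ : i \notin Q.
  apply: contraTN eij => iQ; rewrite edge_sym.
  by apply: stj; rewrite !inE ?eqxx ?iQ ?orbT.
have jQ : j \notin Q.
  by apply: contraTN eij => jQ; apply: sti; rewrite !inE ?eqxx ?jQ ?orbT.
split=> //; move: wi; rewrite -wj /weight !big_setU1//=; exact: addIr.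
Qed.

(* On a critical edge where the bound is tight, the form is constant on the
   segment joining the two corresponding minimizers. *)
Lemma finite_strict : 0 < alpha ->
  finite_set [set x | global_minimizer B x]%classic -> strict_on_critical_edges.
Proof.
move=> a0 fin i j [eij [Q [mi mj]]]; rewrite ltNge; apply/negP => Ble.
have [iQ jQ wij] := max_stable_swap_weight eij mi mj.
have ij : i != j by apply: contraTneq eij => ->; rewrite edge_irr.
have Bij : B i j *+ 2 = B i i + B j j.
  by have := edge_excess_ge0 eij; move: Ble; rewrite !diagB; lra.
pose c := w i / alpha.
have c0 : 0 < c by rewrite divr_gt0.
pose d := unit_vec R i - unit_vec R j.
have Ei : char_vec (i |: Q) = char_vec (j |: Q) + c *: d.
  apply/colP => k; rewrite !mxE !inE !andbT.
  have [->|ki] := eqVneq k i.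
    by rewrite (negPf ij) (negPf iQ)/= subr0 mulr1 add0r.
  have [->|kj] := eqVneq k j; last by rewrite subrr mulr0 addr0.
  by rewrite (negPf jQ)/= sub0r mulrN1 /c wij subrr.
have qd : qform B d = 0.
  rewrite /d qformD// -scaleN1r qformZ bformZr !qformE !bform_unit_vec2.
  by rewrite -[RHS](subrr (B i j *+ 2)) {1}Bij; ring.
(* Points at parameters [1 / (k + 1)] of the segment, an injective sequence starting at
   [char_vec (i |: Q)]. *)
pose seg (k : nat) := char_vec (j |: Q) + (c / k.+1%:R) *: d.
(* As [qform B d = 0], the form is affine along [d]; equal values at the two ends force its slope to
   vanish. *)
have bd : bform B (char_vec (j |: Q)) d = 0.
  have := qform_char_vec a0 mi; rewrite Ei qformD// qformZ qd mulr0 addr0.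
  rewrite qform_char_vec// bformZr => /eqP; rewrite -subr_eq0 addrC addKr.
  by rewrite mulrn_eq0/= mulf_eq0 (gt_eqF c0)/= => /eqP.
have mseg k : global_minimizer B (seg k).
  apply/(global_minimizerE _ a0); split; last first.
    by rewrite /seg qformD// bformZr bd qformZ qd !mulr0 mul0rn !addr0 qform_char_vec.
  have [si0 si1] := char_vec_simplex a0 mi.
  have [sj0 sj1] := char_vec_simplex a0 mj.
  have segE : seg k = k.+1%:R^-1 *: char_vec (i |: Q) +
      (1 - k.+1%:R^-1) *: char_vec (j |: Q).
    rewrite /seg Ei [_^-1 *: _]scalerDr addrAC -scalerDl [_ + (1 - _)]addrC subrK scale1r.
    by rewrite scalerA [c / _]mulrC.
  split=> [l|].
    rewrite segE !mxE -!char_vecE addr_ge0// mulr_ge0// ?invr_ge0//.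
    by rewrite subr_ge0 invf_le1// ler1n.
  rewrite segE; under eq_bigr => l _ do rewrite !mxE -!char_vecE.
  by rewrite big_split -!mulr_sumr/= si1 sj1 !mulr1 addrC subrK.
apply: infinite_nat.
have -> : setT = (seg @^-1` [set x | global_minimizer B x])%classic.
  by apply/seteqP; split=> k // _; exact: mseg.
apply: finite_preimage fin => k l _ _ /(congr1 (fun x : 'cV[R]_n => x i ord0)).
rewrite !mxE eqxx (negPf ij) !subr0 !mulr1 => /addrI /(mulfI (lt0r_neq0 c0)).
by move=> /invr_inj /eqP; rewrite eqr_nat eqSS => /eqP.
Qed.

(** * The optimality conditions at the minimizers *)

(** At [u = char_vec (j |: Q)] the index [i] is active. Having no neighbour in [Q], row [i] of
    [B *m u] receives only the contribution of [j], and tightness with [w i = w j] makes it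
    [alpha^-1], the value of row [j]. So [mu i = mu j = 0], against strict complementarity. *)
Lemma conditions_strict : 0 < alpha ->
  (forall u, global_minimizer B u -> optimality_conditions B u) ->
  strict_on_critical_edges.
Proof.
move=> a0 cond i j [eij [Q [mi mj]]]; rewrite ltNge; apply/negP => Ble.
have [iQ jQ wij] := max_stable_swap_weight eij mi mj.
have ij : i != j by apply: contraTneq eij => ->; rewrite edge_irr.
have Bij : B i j *+ 2 = B i i + B j j.
  by have := edge_excess_ge0 eij; move: Ble; rewrite !diagB; lra.
have [lam [mu [[gradE _] [mu_pos mu0] _]]] :=
  cond _ (global_minimizer_char_vec a0 mj).
set u := char_vec (j |: Q) in gradE mu_pos mu0.
have FO k : 2 * (B *m u) k ord0 = lam + mu k.
  move/colP: gradE => /(_ k); rewrite grad_qform// mxE => ->.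
  by rewrite mxE sum_unit_vecE !mxE mulr1.
have ui : u i ord0 = 0 by rewrite char_vec_notin// !inE negb_or ij.
have uj : u j ord0 = w j / alpha by rewrite char_vecE !inE eqxx.
have jact : j \notin active u.
  by rewrite !inE uj gt_eqF// divr_gt0.
have := mu_pos i; rewrite !inE ui eqxx => /(_ isT).
have := FO i; have := FO j; rewrite (mu0 j jact) addr0.
have -> : (B *m u) j ord0 = alpha^-1.
  case: mj => stj _; rewrite (mulmx_stable stj (@char_vec_notin _)) ?setU11//.
  by rewrite -/u uj mulrAC divff ?mul1r// gt_eqF.
have -> : (B *m u) i ord0 = alpha^-1.
  rewrite mxE (bigD1 j)//= big1 ?addr0 => [|k kj].
    have -> : B i j = (w i)^-1 by move: Bij; rewrite !diagB -wij; lra.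
    by rewrite uj -wij mulrA mulVf ?mul1r// gt_eqF.
  have [->|ki] := eqVneq k i; first by rewrite ui mulr0.
  have [kQ|kQ] := boolP (k \in Q); last first.
    by rewrite [X in _ * X]char_vec_notin ?mulr0// !inE negb_or kj.
  case: hB => _ _ _ ->; rewrite ?mul0r 1?eq_sym//.
  by case: mi => /stableP + _; apply; rewrite !inE ?eqxx ?kQ ?orbT.
by lra.
Qed.

(* By exchange, the neighbours of [i] in [S] have total weight at least [w i];
   in the only tight case, a single neighbour [j] of weight [w i], the edge [ij]
   is critical. *)
Lemma max_stable_outside S i : 0 < alpha -> strict_on_critical_edges ->
  max_stable e w S -> i \notin S -> alpha^-1 < (B *m char_vec S) i ord0.
Proof.
move=> a0 strict mS iS; have [/stableP stS wS] := mS.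
pose N : {set 'I_n} := finset (fun j => (j \in S) && e i j).
have NS : N \subset S by apply/fintype.subsetP => j; rewrite inE => /andP[].
have -> : (B *m char_vec S) i ord0 = \sum_(j in N) B i j * (w j / alpha).
  rewrite mxE [RHS]big_mkcond; apply: eq_bigr => j _; rewrite char_vecE inE.
  case: ifP => jS; last by rewrite mulr0.
  case: ifPn => // nij; case: hB => _ _ _ ->; rewrite ?mul0r//.
  by apply: contraNneq iS => ->.
have iSN : i \notin S :\: N by rewrite inE (negPf iS) andbF.
have stT : stable e (i |: (S :\: N)).
  apply/stableP => k l; rewrite !inE !negb_and.
  case/orP => [/eqP->|/andP[kN kS]]; case/orP => [/eqP->|/andP[lN lS]].
  - by rewrite edge_irr.
  - by move: lN; rewrite lS.
  - by move: kN; rewrite kS edge_sym.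
  - exact: stS.
have wT : weight w (i |: (S :\: N)) = w i + (alpha - weight w N).
  rewrite /weight big_setU1//= -wS /weight; congr (_ + _).
  by rewrite [X in _ = X - _](big_setID N)/= (finset.setIidPr NS) addrAC subrr add0r.
have wN : w i <= weight w N.
  by have := weight_le_alpha stT; rewrite wT; lra.
have [N0|[j jN]] := set_0Vmem N.
  by move: wN; rewrite /weight N0 big_set0 leNgt hw.
have [jS eij] : j \in S /\ e i j by move: jN; rewrite inE => /andP.
have Bw k : k \in N -> 2^-1 * (w k / w i + 1) / alpha <= B i k * (w k / alpha).
  rewrite inE => /andP[_ eik]; rewrite mulrA ler_pM2r ?invr_gt0//.
  have -> : 2^-1 * (w k / w i + 1) = 2^-1 * (B i i + B k k) * w k.
    by rewrite !diagB; field; rewrite !gt_eqF.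
  by rewrite ler_pM2r//; case: hB => _ _ + _; apply.
have sumN : \sum_(k in N) 2^-1 * (w k / w i + 1) / alpha =
    2^-1 * (weight w N / w i + #|N|%:R) / alpha.
  rewrite -mulr_suml -mulr_sumr big_split/= -mulr_suml -/(weight w N).
  by rewrite sumr_const.
(* The averaged bound [(weight w N / w i + #|N|) / 2] exceeds 1 once [N] has two elements. For a
   single neighbour [j], strictness comes from [w i < w j], or from criticality of the edge if the
   weights agree. *)
have [NE|Nj] := eqVneq N [set j]%SET; last first.
  apply: (@lt_le_trans _ _ (\sum_(k in N) 2^-1 * (w k / w i + 1) / alpha)).
    rewrite sumN.
    rewrite -[ltLHS]mul1r ltr_pM2r ?invr_gt0//.
    have N2 : (2 <= #|N|)%N.
      rewrite ltnNge; apply: contra_neqN Nj => N1; apply/esym/eqP.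
      by rewrite eqEcard finset.sub1set jN cards1.
    have : 2 <= #|N|%:R :> R by rewrite ler_nat.
    have : 0 < weight w N / w i by rewrite divr_gt0// (lt_le_trans (hw i)).
    by lra.
  by apply: ler_sum => k; exact: Bw.
rewrite NE big_set1 -[ltLHS]mul1r mulrA ltr_pM2r ?invr_gt0//.
have wNE : weight w N = w j by rewrite /weight NE big_set1.
rewrite -ltr_pdivrMr// div1r.
have [wij|wij] := eqVneq (w i) (w j); last first.
  have lij : w i < w j by rewrite lt_neqAle wij -wNE.
  apply: (@lt_le_trans _ _ (2^-1 * (B i i + B j j))); last first.
    by case: hB => _ _ + _; apply.
  by rewrite !diagB; have : (w j)^-1 < (w i)^-1; [rewrite ltf_pV2 ?posrE|lra].
suff /strict : critical_edge e w i j by rewrite wij; lra.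
split=> //; exists (S :\: N); split; first by split=> //; rewrite wT wNE wij; lra.
suff -> : j |: (S :\: N) = S by [].
by rewrite NE finset.setD1K.
Qed.

Lemma strict_conditions u : 0 < alpha -> strict_on_critical_edges ->
  global_minimizer B u -> optimality_conditions B u.
Proof.
move=> a0 strict mu; have stu := minimizer_support_stable a0 strict mu.
have [mS uE] := global_minimizer_stable a0 mu stu.
set S := support u in stu mS uE.
have actE i : (i \in active u) = (i \notin S) by rewrite finset.in_setC negbK.
have BuS i : i \in S -> (B *m u) i ord0 = alpha^-1.
  move=> iS; rewrite (mulmx_stable stu (@notin_support u))// {1}uE char_vecE iS.
  by rewrite mulrAC divff ?mul1r// gt_eqF.
have BuNS i : i \notin S -> alpha^-1 < (B *m u) i ord0.
  by rewrite uE; exact: max_stable_outside.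
(* These multipliers are forced: the gradient is [2 *: (B *m u)], equal to [2 / alpha] on the
   support, where [mu] must vanish. Off the support, [max_stable_outside] gives positivity. *)
exists (2 / alpha), (fun i => 2 * ((B *m u) i ord0 - alpha^-1)); split.
- split.
    apply/colP => i; rewrite grad_qform// mxE [RHS]mxE sum_unit_vecE.
    by rewrite 2![in RHS]mxE; ring.
  move=> i; have [iS|iS] := boolP (i \in S).
    by rewrite BuS// subrr mulr0 mul0r.
  by rewrite (notin_support iS) mulr0 pmulr_rge0// subr_ge0 ltW// BuNS.
- split=> i; rewrite actE; first by move=> iS; rewrite pmulr_rgt0// subr_gt0 BuNS.
  by rewrite negbK => iS; rewrite BuS// subrr mulr0.
(* The direction [v] is supported on the stable set [S], where the form is diagonal with positive
   coefficients [(w i)^-1]. *)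
- move=> v v0 _ vact; rewrite hess_lagrangian//.
  rewrite -scalemxAr -scalemxAl mxE -/(qform B v) pmulr_rgt0//.
  have vS i : i \notin S -> v i ord0 = 0 by rewrite -actE; exact: vact.
  rewrite (qform_stable stu vS).
  have q0 i : i \in S -> 0 <= v i ord0 ^+ 2 / w i.
    by move=> _; rewrite divr_ge0 ?sqr_ge0 ?ltW.
  rewrite lt_def sumr_ge0 ?andbT//.
  apply: contra v0 => /eqP/(psumr_eq0P q0) z; apply/eqP/colP => i; rewrite mxE.
  have [iS|/vS//] := boolP (i \in S).
  have /eqP := z i iS; rewrite mulf_eq0 invr_eq0 (gt_eqF (hw i)) orbF.
  by rewrite expf_eq0/= => /eqP.
Qed.

End WeightedGraph.

(** * The equivalences and the list of minimizers *)

Theorem proposition4p5 (R : realType) (n : nat) (hn : (0 < n)%N)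
    (e : rel 'I_n) (he : simple_graph e)
    (w : 'I_n -> R) (hw : forall i, 0 < w i)
    (B : 'M[R]_n) (hB : Mclass e w B) :
  let finitely_many_minimizers :=
    finite_set [set x : 'cV[R]_n | global_minimizer B x]%classic in
  let strict_on_critical_edges :=
    forall i j : 'I_n, critical_edge e w i j ->
      2^-1 * ((w i)^-1 + (w j)^-1) < B i j in
  let conditions_at_minimizers :=
    forall u : 'cV[R]_n, global_minimizer B u -> optimality_conditions B u in
  [/\ optimal_value B (alpha e w)^-1,
      finitely_many_minimizers <-> strict_on_critical_edges,
      strict_on_critical_edges <-> conditions_at_minimizers
    & finitely_many_minimizers ->
      forall x : 'cV[R]_n, global_minimizer B x <->
        exists S : {set 'I_n},
          [/\ max_stable e w S, simplex x,
              forall i, i \in S -> x i ord0 = w i / alpha e w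
            & forall i, i \notin S -> x i ord0 = 0]].
Proof.
have a0 := alpha_gt0 he hw hn.
split.
- exact: optimal_valueE.
- by split; [exact: finite_strict|exact: strict_finite].
- split; last exact: conditions_strict.
  by move=> strict u; exact: (strict_conditions he hw hB a0 strict).
- move=> /(finite_strict he hw hB a0) strict x; split=> [mx|[S [mS _ xS xNS]]].
    have [sx _] := mx; have stx := minimizer_support_stable he hw hB a0 strict mx.
    have [mS xE] := global_minimizer_stable he hw hB a0 mx stx.
    exists (support x); split=> // i; last exact: notin_support.
    by move=> iS; rewrite {1}xE char_vecE iS.
  suff -> : x = char_vec e w S by exact: global_minimizer_char_vec.
  by apply/colP => i; rewrite char_vecE; case: ifPn => [/xS|/xNS].
Qed.
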